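(* Let $K\subset M^{m\times n}$ be a linear subspace. Let $M_1,\dots,M_{q_1}:M^{m\times n}\to\mathbb{R}$ be all the minors of $m\times n$ matrices, and let $M_{q_1+1},\dots,M_{q_1+mn}:M^{m\times n}\to\mathbb{R}$ be the projections onto the $mn$ entries. Then $\mathcal{M}^{pc}(K)$ consists of Dirac measures if and only if the following holds: for each non-trivial algebraic cone $V\subset K$ there exists $\beta\in\mathbb{R}^{q_1+mn}\setminus\{0\}$ such that $\sum_{k=1}^{q_1+mn}\beta_k M_k(\zeta)\ge 0$ for all $\zeta\in V$ and $\sum_{k=1}^{q_1+mn}\beta_k M_k\not\equiv 0$ on $V$.
   Context: $M^{m\times n}$ denotes real $m\times n$ matrices, identified with $\mathbb{R}^{mn}$. For $X\in M^{m\times n}$, $\hat X$ is the vector of all minors of $X$; a function $f:M^{m\times n}\to\mathbb{R}$ is polyconvex if $f(X)=g(\hat X)$ for some convex $g$. For a set $\mathcal{K}\subset M^{m\times n}$, $\mathcal{M}^{pc}(\mathcal{K})$ is the set of probability measures $\nu$ on $M^{m\times n}$ with $\mathrm{Spt}\,\nu\subset\mathcal{K}$ and $\int f\,d\nu\ge f(\overline X)$ for all polyconvex $f$, where $\overline X=\int X\,d\nu(X)$ (equivalently $\int M(X)\,d\nu=M(\overline X)$ for every minor $M$). A set $S\subset\mathbb{R}^N$ is a cone if $\lambda x\in S$ whenever $x\in S$, $\lambda>0$; an algebraic set is the common zero locus of a collection of real polynomials; an algebraic cone is a cone that is an algebraic set. Non-trivial means not equal to $\{0\}$. *)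

(* Defs.v *)
From HB Require Import structures.
From mathcomp Require Import all_boot all_order all_algebra.
From mathcomp Require Import all_classical all_reals all_analysis.
From mathcomp Require mpoly.
Set Implicit Arguments. Unset Strict Implicit. Unset Printing Implicit Defensive.
Import Order.TTheory GRing.Theory Num.Theory.
Import numFieldNormedType.Exports.
Local Open Scope classical_set_scope.
Local Open Scope ring_scope.

Definition Mx (R : realType) (m n : nat)
  : measurableType (@open 'M[R]_(m, n)).-sigma :=
  g_sigma_algebraType (@open 'M[R]_(m, n)).

Definition minor_index (m n : nat) :=
  {p : {set 'I_m} * {set 'I_n} | (#|p.1| == #|p.2|) && (0 < #|p.1|)%N}.

Lemma minor_index_card m n (p : minor_index m n) : #|(val p).1| = #|(val p).2|.
Proof. by case/andP: (valP p) => /eqP. Qed.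

Definition minor (R : realType) m n (p : minor_index m n) (X : 'M[R]_(m, n)) : R :=
  \det (\matrix_(i < #|(val p).1|, j < #|(val p).1|)
          X (enum_val i) (enum_val (cast_ord (minor_index_card p) j))).

Definition support (R : realType) m n
    (nu : {measure set (Mx R m n) -> \bar R}) : set 'M[R]_(m, n) :=
  [set x | forall U : set 'M[R]_(m, n), open U -> U x -> (0 < nu U)%E].

Definition barycenter (R : realType) m n (nu : probability (Mx R m n) R)
    : 'M[R]_(m, n) :=
  \matrix_(i, j) fine (\int[nu]_(x in [set: Mx R m n]) ((x : 'M[R]_(m, n)) i j)%:E)%E.

Definition Mpc (R : realType) m n (K : set 'M[R]_(m, n))
    (nu : probability (Mx R m n) R) : Prop :=
  support nu `<=` K /\
  (forall p : minor_index m n,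
     nu.-integrable [set: Mx R m n] (fun x => (minor p (x : 'M[R]_(m, n)))%:E)) /\
  (forall p : minor_index m n,
     (\int[nu]_(x in [set: Mx R m n]) (minor p (x : 'M[R]_(m, n)))%:E)%E
       = (minor p (barycenter nu))%:E).

Definition is_dirac (R : realType) m n (nu : probability (Mx R m n) R) : Prop :=
  exists a : Mx R m n, forall A : set (Mx R m n), measurable A ->
    nu A = @dirac _ (Mx R m n) a R A.

Definition is_subspace (R : realType) m n (K : set 'M[R]_(m, n)) : Prop :=
  K 0 /\ forall (a : R) x y, K x -> K y -> K (a *: x + y).

Definition is_cone (R : realType) m n (V : set 'M[R]_(m, n)) : Prop :=
  forall x (l : R), V x -> 0 < l -> V (l *: x).

Definition is_algebraic (R : realType) m n (V : set 'M[R]_(m, n)) : Prop :=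
  exists S : set (mpoly.mpoly (m * n) R),
    V = [set X | forall P, S P -> mpoly.meval (fun i => mxvec X 0 i) P = 0].

(* sum_k beta_k M_k(X), with beta split into minor coefficients and entry
   coefficients. *)
Definition lincomb (R : realType) m n (bm : minor_index m n -> R)
    (be : 'M[R]_(m, n)) (X : 'M[R]_(m, n)) : R :=
  \sum_(p : minor_index m n) bm p * minor p X + \sum_(i < m) \sum_(j < n) be i j * X i j.

(* Main.v *)
(** If every nonnegative combination of minors on a nontrivial algebraic cone
    V in K vanished on V, the convex cone spanned by the minor vectors of V
    would be a linear subspace (Riesz extension); hence the opposite of the
    minor vector of some z <> 0 in V is a finite positive combination of minor
    vectors of V, and normalizing the weights gives a finitely supported
    element of M^pc(K) with barycenter 0 that charges z.

    Conversely let nu be in M^pc(K), with barycenter A and support S. Minors of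
    X - A are affine in the minors of X, so homogeneous combinations f of minors
    satisfy int f(X - A) dnu = f(0) = 0. Let V be the common zero set of those f
    that vanish on S - A: an algebraic cone in K containing S - A. If V is
    nontrivial, the lowest homogeneous part, among those not identically zero
    on V, of the given nonnegative combination is nonnegative on V and of mean
    zero, so it vanishes on S - A, hence on V, a contradiction. So S = {A}. *)
Require Import Defs.
From HB Require Import structures.
From mathcomp Require Import all_boot all_order all_algebra all_fingroup.
From mathcomp Require Import all_classical all_reals all_analysis.
From mathcomp Require Import measurable_realfun lra.
From mathcomp Require mpoly.
Import (canonicals) mpoly.
Import Order.TTheory GRing.Theory Num.Theory.
Import numFieldNormedType.Exports.
Local Open Scope classical_set_scope.
Local Open Scope ring_scope.

(** * Affine combinations of minors and their stability under translation *)

Section minors.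
Context {R : realType} {m n : nat}.
Implicit Types (X B : 'M[R]_(m, n)) (phi psi : 'M[R]_(m, n) -> R).

(** The constant plays the part of the minor of order 0, which [minor_index] excludes; it appears as
    the cofactor in a minor of order 1. *)
Definition minor_affine phi := exists (c : R) (b : minor_index m n -> R),
  forall X, phi X = c + \sum_p b p * minor p X.

Lemma minor_affine_cst c : minor_affine (fun=> c).
Proof. by exists c, (fun=> 0) => X; rewrite big1 ?addr0// => p _; rewrite mul0r. Qed.

Lemma minor_affine_minor p : minor_affine (minor p).
Proof.
exists 0, (fun q => (q == p)%:R) => X; rewrite add0r (bigD1 p)//= eqxx mul1r.
by rewrite big1 ?addr0// => q /negbTE ->; rewrite mul0r.
Qed.

Lemma minor_affineD phi psi :
  minor_affine phi -> minor_affine psi -> minor_affine (fun X => phi X + psi X).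
Proof.
move=> [c [b phiE]] [d [e psiE]]; exists (c + d), (fun p => b p + e p) => X.
rewrite phiE psiE addrACA -big_split/=; congr (_ + _).
by apply: eq_bigr => p _; rewrite mulrDl.
Qed.

Lemma minor_affineZ a phi : minor_affine phi -> minor_affine (fun X => a * phi X).
Proof.
move=> [c [b phiE]]; exists (a * c), (fun p => a * b p) => X.
by rewrite phiE mulrDr mulr_sumr; congr (_ + _); apply: eq_bigr => p _; rewrite mulrA.
Qed.

Lemma minor_affine_eq phi psi : phi =1 psi -> minor_affine phi -> minor_affine psi.
Proof. by move=> /funext <-. Qed.

Lemma minor_affine_sum (I : finType) (f : I -> 'M[R]_(m, n) -> R) :
  (forall i, minor_affine (f i)) -> minor_affine (fun X => \sum_i f i X).
Proof.
move=> fP; elim: (index_enum I) => [|i s IH].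
  by apply: minor_affine_eq (minor_affine_cst 0) => X; rewrite big_nil.
apply: minor_affine_eq (minor_affineD _ _ (fP i) IH) => X; by rewrite big_cons.
Qed.

Lemma minor_mxsub (p : minor_index m n) X : minor p X =
  \det (mxsub enum_val (fun j => enum_val (cast_ord (minor_index_card p) j)) X).
Proof. by congr (\det _); apply/matrixP => i j; rewrite !mxE. Qed.

Lemma det_mxsub_cast (T : comPzRingType) (r s k l : nat) (e : k = l)
    (f : 'I_l -> 'I_r) (g : 'I_l -> 'I_s) (X : 'M[T]_(r, s)) :
  \det (mxsub (f \o cast_ord e) (g \o cast_ord e) X) = \det (mxsub f g X).
Proof.
case: l / e f g => f g; congr (\det _); apply/matrixP => i j; rewrite !mxE /=.
by rewrite !cast_ord_id.
Qed.

Lemma eq_image_perm (T : finType) (k : nat) (f g : 'I_k -> T) :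
  injective f -> injective g -> f @: 'I_k = g @: 'I_k ->
  exists s : {perm 'I_k}, f =1 g \o s.
Proof.
move=> fI gI fg.
have sP i : exists j, f i == g j.
  have /imsetP[j _ ->] : f i \in g @: 'I_k by rewrite -fg imset_f.
  by exists j.
pose s i := xchoose (sP i); have fs i : f i = g (s i) by apply/eqP/(xchooseP (sP i)).
have sI : injective s by move=> i j ij; apply: fI; rewrite !fs ij.
by exists (perm sI) => i; rewrite /= permE.
Qed.

Lemma det_mxsub_perm (T : comPzRingType) (r s k : nat) (f : 'I_k -> 'I_r)
    (g : 'I_k -> 'I_s) (u v : {perm 'I_k}) (X : 'M[T]_(r, s)) :
  \det (mxsub (f \o u) (g \o v) X) = (-1) ^+ u * (-1) ^+ v * \det (mxsub f g X).
Proof.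
have -> : mxsub (f \o u) (g \o v) X = row_perm u (col_perm v (mxsub f g X)).
  by apply/matrixP => i j; rewrite !mxE.
rewrite row_permE col_permE !det_mulmx !det_perm odd_permV.
by rewrite -mulrA; congr (_ * _); rewrite mulrC.
Qed.

(** A repeated row or column index gives 0, and an empty selection gives 1. Otherwise [f] and [g]
    differ by permutations from the enumerations of their images, so the determinant is a minor up
    to sign. *)
Lemma minor_affine_det_mxsub k (f : 'I_k -> 'I_m) (g : 'I_k -> 'I_n) :
  minor_affine (fun X => \det (mxsub f g X)).
Proof.
have [fI|fI] := boolP (injectiveb f); last first.
  apply: minor_affine_eq (minor_affine_cst 0) => X.
  case/injectivePn: fI => i [j ij fij]; apply/esym/(determinant_alternate ij) => l.
  by rewrite !mxE fij.
have [gI|gI] := boolP (injectiveb g); last first.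
  apply: minor_affine_eq (minor_affine_cst 0) => X.
  case/injectivePn: gI => i [j ij fij]; rewrite -det_tr.
  apply/esym/(determinant_alternate ij) => l; by rewrite !mxE fij.
move/injectiveP : fI => fI; move/injectiveP : gI => gI.
case: k f g fI gI => [|k] f g fI gI.
  by apply: minor_affine_eq (minor_affine_cst 1) => X; rewrite det_mx00.
have fC : #|f @: 'I_k.+1| = k.+1 by rewrite card_imset// card_ord.
have gC : #|g @: 'I_k.+1| = k.+1 by rewrite card_imset// card_ord.
have pP : (#|(f @: 'I_k.+1, g @: 'I_k.+1).1| == #|(f @: 'I_k.+1, g @: 'I_k.+1).2|)
  && (0 < #|(f @: 'I_k.+1, g @: 'I_k.+1).1|)%N by rewrite /= fC gC eqxx.
pose p : minor_index m n := exist _ (f @: 'I_k.+1, g @: 'I_k.+1) pP.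
have e : k.+1 = #|(val p).1| by rewrite fC.
pose f' : 'I_k.+1 -> 'I_m := enum_val \o cast_ord e.
pose g' : 'I_k.+1 -> 'I_n :=
  (fun j => enum_val (cast_ord (minor_index_card p) j)) \o cast_ord e.
have f'I : injective f' by move=> i j /enum_val_inj /cast_ord_inj.
have g'I : injective g' by move=> i j /enum_val_inj /cast_ord_inj /cast_ord_inj.
have f'E : f @: 'I_k.+1 = f' @: 'I_k.+1.
  apply/esym/eqP; rewrite eqEcard fC (card_imset _ f'I) card_ord leqnn andbT.
  by apply/fintype.subsetP => _ /imsetP[i _ ->]; exact: (@enum_valP _ (mem (val p).1)).
have g'E : g @: 'I_k.+1 = g' @: 'I_k.+1.
  apply/esym/eqP; rewrite eqEcard gC (card_imset _ g'I) card_ord leqnn andbT.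
  by apply/fintype.subsetP => _ /imsetP[i _ ->]; exact: (@enum_valP _ (mem (val p).2)).
have [u uE] := eq_image_perm _ _ _ _ fI f'I f'E.
have [v vE] := eq_image_perm _ _ _ _ gI g'I g'E.
apply: minor_affine_eq (minor_affineZ ((-1) ^+ u * (-1) ^+ v) _ (minor_affine_minor p)).
move=> X; rewrite (funext uE) (funext vE) det_mxsub_perm; congr (_ * _).
by rewrite minor_mxsub -(det_mxsub_cast _ _ _ _ _ e).
Qed.

(** Expand along row [i]: the cofactors of that row do not see the perturbed entry. *)
Lemma det_add_delta (T : comNzRingType) (k : nat) (A : 'M[T]_k) (i j : 'I_k) (t : T) :
  \det (A + t *: delta_mx i j) = \det A + t * cofactor A i j.
Proof.
have cofE l : cofactor (A + t *: delta_mx i j) i l = cofactor A i l.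
  congr (_ * \det _); apply/matrixP => a b; rewrite !mxE.
  by rewrite eq_sym (negbTE (neq_lift _ _)) mulr0 addr0.
rewrite !(expand_det_row _ i).
under eq_bigr do rewrite cofE !mxE eqxx mulrDl.
rewrite big_split/=; congr (_ + _); rewrite (bigD1 j)//= eqxx mulr1 big1 ?addr0//.
by move=> l /negbTE ->; rewrite mulr0 mul0r.
Qed.

(** A minor that misses row [i] or column [j] is unchanged. Otherwise it gains [t] times a cofactor,
    which up to sign is again a determinant of selected rows and columns. *)
Lemma minor_affine_translate_delta phi (t : R) i j :
  minor_affine phi -> minor_affine (fun X => phi (X + t *: delta_mx i j)).
Proof.
move=> [c [b phiE]].
apply: (@minor_affine_eq (fun X => c + \sum_p b p * minor p (X + t *: delta_mx i j))).
  by move=> X; rewrite phiE.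
apply: minor_affineD; first exact: minor_affine_cst.
apply: minor_affine_sum => p; apply: minor_affineZ.
set f := (@enum_val _ (mem (val p).1)).
pose g j := enum_val (cast_ord (minor_index_card p) j).
have [[a fa]|ni] := pselect (exists a, f a = i); last first.
  apply: minor_affine_eq (minor_affine_minor p) => X.
  rewrite !minor_mxsub; congr (\det _); apply/matrixP => x y; rewrite !mxE.
  by case: eqP => [e|_]; [case: ni; exists x | rewrite mulr0 addr0].
have [[a' ga]|ni] := pselect (exists a, g a = j); last first.
  apply: minor_affine_eq (minor_affine_minor p) => X.
  rewrite !minor_mxsub; congr (\det _); apply/matrixP => x y; rewrite !mxE.
  case: (enum_val _ =P j) => [e|_]; last by rewrite andbF mulr0 addr0.
  by case: ni; exists y.
apply: (@minor_affine_eq (fun X => minor p X + t * cofactor (mxsub f g X) a a')).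
  move=> X; rewrite !minor_mxsub -det_add_delta; congr (\det _).
  apply/matrixP => x y; rewrite !mxE; congr (_ + _ * (_ && _)%:R).
    by rewrite -fa (inj_eq enum_val_inj).
  by rewrite -ga /g (inj_eq enum_val_inj) (inj_eq (@cast_ord_inj _ _ _)).
apply: minor_affineD; [exact: minor_affine_minor|do 2!apply: minor_affineZ].
apply: minor_affine_eq (minor_affine_det_mxsub _ (f \o lift a) (g \o lift a')) => X.
by congr (\det _); apply/matrixP => x y; rewrite !mxE.
Qed.

Lemma minor_affine_translate phi B :
  minor_affine phi -> minor_affine (fun X => phi (X + B)).
Proof.
rewrite (matrix_sum_delta B) pair_bigA /=.
elim: (index_enum _) phi => [|i s IH] phi phiP.
  by apply: minor_affine_eq phiP => X; rewrite big_nil addr0.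
apply: (@minor_affine_eq (fun X => phi (X + \sum_(p <- s) B p.1 p.2 *: delta_mx p.1 p.2
    + B i.1 i.2 *: delta_mx i.1 i.2))).
  by move=> X; rewrite big_cons -addrA; congr (phi (_ + _)); rewrite addrC.
apply: (IH (fun X => phi (X + B i.1 i.2 *: delta_mx i.1 i.2))).
exact: minor_affine_translate_delta.
Qed.

Lemma minorZ (p : minor_index m n) (a : R) X :
  minor p (a *: X) = a ^+ #|(val p).1| * minor p X.
Proof.
rewrite !minor_mxsub -detZ; congr (\det _).
by apply/matrixP => x y; rewrite !mxE.
Qed.

Lemma minor0 (p : minor_index m n) : minor p (0 : 'M[R]_(m, n)) = 0.
Proof.
have /andP[_ p0] := valP p.
by rewrite -(scale0r 0) minorZ expr0n -leqn0 leqNgt p0/= mul0r.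
Qed.

End minors.

(** * Minors as polynomial, continuous and measurable functions *)

Section polynomial_functions.
Context {R : realType} {m n : nat}.
Implicit Types (f g : 'M[R]_(m, n) -> R).

(** Leibniz's formula builds a minor from constants and entries by sums and products. This serves
    for polynomiality and for continuity. *)
Lemma minor_closed (Q : ('M[R]_(m, n) -> R) -> Prop) :
  (forall c, Q (fun=> c)) -> (forall i j, Q (fun X => X i j)) ->
  (forall f g, Q f -> Q g -> Q (fun X => f X + g X)) ->
  (forall f g, Q f -> Q g -> Q (fun X => f X * g X)) ->
  forall p, Q (minor p).
Proof.
move=> Qc Qe QD QM p.
have Qprod (I : Type) (s : seq I) (f : I -> 'M[R]_(m, n) -> R) :
    (forall i, Q (f i)) -> Q (fun X => \prod_(i <- s) f i X).
  move=> fQ; elim: s => [|i s IH].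
    by rewrite (_ : (fun _ => _) = fun=> 1)//; apply/funext => X; rewrite big_nil.
  rewrite (_ : (fun _ => _) = fun X => f i X * \prod_(i <- s) f i X); first exact: QM.
  by apply/funext => X; rewrite big_cons.
have Qsum (I : Type) (s : seq I) (f : I -> 'M[R]_(m, n) -> R) :
    (forall i, Q (f i)) -> Q (fun X => \sum_(i <- s) f i X).
  move=> fQ; elim: s => [|i s IH].
    by rewrite (_ : (fun _ => _) = fun=> 0)//; apply/funext => X; rewrite big_nil.
  rewrite (_ : (fun _ => _) = fun X => f i X + \sum_(i <- s) f i X); first exact: QD.
  by apply/funext => X; rewrite big_cons.
rewrite /minor /determinant; apply: Qsum => s; apply: QM; first exact: Qc.
rewrite (_ : (fun _ => _) = fun X : 'M[R]_(m, n) => \prod_i X (enum_val i)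
   (enum_val (cast_ord (minor_index_card p) (s i)))); first exact: Qprod.
by apply/funext => X; apply: eq_bigr => i _; rewrite mxE.
Qed.

Definition polynomial_fun f := exists P : mpoly.mpoly (m * n) R,
  forall X, mpoly.meval (fun i => mxvec X 0 i) P = f X.

Lemma polynomial_fun_cst c : polynomial_fun (fun=> c).
Proof. by exists (mpoly.mpolyC _ c) => X; rewrite mpoly.mevalC. Qed.

Lemma polynomial_funD f g : polynomial_fun f -> polynomial_fun g ->
  polynomial_fun (fun X => f X + g X).
Proof. by move=> [P fE] [Q gE]; exists (P + Q) => X; rewrite mpoly.mevalD fE gE. Qed.

Lemma polynomial_funM f g : polynomial_fun f -> polynomial_fun g ->
  polynomial_fun (fun X => f X * g X).
Proof. by move=> [P fE] [Q gE]; exists (P * Q) => X; rewrite mpoly.mevalM fE gE. Qed.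

Lemma polynomial_fun_minor p : polynomial_fun (minor p).
Proof.
apply: minor_closed p; [exact: polynomial_fun_cst| |exact: polynomial_funD|exact: polynomial_funM].
move=> i j; exists (mpoly.mpolyX R (mpoly.mnm1 (mxvec_index i j))) => X.
by rewrite mpoly.mevalXU mxvecE.
Qed.

Lemma polynomial_fun_minor_sum (b : minor_index m n -> R) :
  polynomial_fun (fun X => \sum_p b p * minor p X).
Proof.
elim: (index_enum _) => [|p s [P PE]].
  by exists 0 => X; rewrite big_nil mpoly.meval0.
have [Q QE] := polynomial_funM _ _ (polynomial_fun_cst (b p)) (polynomial_fun_minor p).
by exists (Q + P) => X; rewrite big_cons mpoly.mevalD PE QE.
Qed.

Lemma continuous_minor p : continuous (@minor R m n p).
Proof.
apply: (minor_closed (fun f => continuous f)) p => [c|i j|f g cf cg|f g cf cg].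
- exact: cst_continuous.
- exact: coord_continuous.
- by move=> x; exact: (cvgD (cf x) (cg x)).
- by move=> x; exact: (cvgM (cf x) (cg x)).
Qed.

Lemma continuous_minor_sum (b : minor_index m n -> R) :
  continuous (fun X : 'M[R]_(m, n) => \sum_p b p * minor p X).
Proof.
elim: (index_enum _) => [|p s IH].
  rewrite (_ : (fun _ => _) = fun=> 0); first exact: cst_continuous.
  by apply/funext => X; rewrite big_nil.
rewrite (_ : (fun _ => _) = fun X => b p * minor p X + \sum_(p <- s) b p * minor p X).
  have bp : continuous (fun X => b p * minor p X).
    by move=> x; exact: (cvgM (cvg_cst (b p)) (continuous_minor p x)).
  by move=> x; exact: (cvgD (bp x) (IH x)).
by apply/funext => X; rewrite big_cons.
Qed.

Lemma continuous_measurable_mx f : continuous f ->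
  measurable_fun [set: Mx R m n] (f : Mx R m n -> R).
Proof.
move=> /continuousP cf; apply: (measurability _ (measurable_realfun.RGenOpens.measurableE R)).
move=> _ [_ [a [b ->]] <-]; rewrite setTI; apply: sub_sigma_algebra.
exact/cf/itv_open.
Qed.

End polynomial_functions.

(** * The complement of the support is negligible *)

Section support.
Context {R : realType} {m n : nat}.
Variable nu : {measure set (Mx R m n) -> \bar R}.

(** These boxes are a base of the topology, indexed by a countable type. *)
Definition rat_box (q : 'M[rat * rat]_(m, n)) : set 'M[R]_(m, n) :=
  [set X | forall i j, ratr (q i j).1 < X i j < ratr (q i j).2].

Lemma nbhs_rat_box (x : 'M[R]_(m, n)) (U : set 'M[R]_(m, n)) :
  nbhs x U -> exists2 q, rat_box q x & rat_box q `<=` U.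
Proof.
move=> [P nP PU].
have qP i j : exists q : rat * rat, ratr q.1 < x i j < ratr q.2 /\
    forall y, ratr q.1 < y < ratr q.2 -> P i j y.
  have /nbhs_ballP[e /= e0 eP] := nP i j.
  have /rat_in_itvoo[a] : x i j - e < x i j by rewrite ltrBlDr ltrDl.
  rewrite in_itv/= => /andP[ea ax].
  have /rat_in_itvoo[b] : x i j < x i j + e by rewrite ltrDl.
  rewrite in_itv/= => /andP[xb be].
  exists (a, b); split; first by rewrite ax xb.
  move=> y /= /andP[ay yb]; apply: eP; rewrite /ball/= ltr_distlC.
  by rewrite (lt_trans ea ay) (lt_trans yb be).
exists (\matrix_(i, j) projT1 (cid (qP i j))).
  by move=> i j; rewrite mxE; case: (projT2 (cid (qP i j))).
move=> y qy; apply: PU => i j; have [_] := projT2 (cid (qP i j)).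
by apply; have := qy i j; rewrite mxE.
Qed.

(** A point outside the support has a null open neighbourhood, hence lies in a negligible rational
    box, and there are only countably many such boxes. *)
Lemma support_conull : nu.-negligible (~` Defs.support nu : set (Mx R m n)).
Proof.
(* Codes that do not decode to a negligible box contribute the empty set. *)
pose F k := if @unpickle 'M[rat * rat]_(m, n) k is Some q
  then if `[< nu.-negligible (rat_box q : set (Mx R m n)) >]
       then (rat_box q : set (Mx R m n)) else set0 else set0.
apply: (@negligibleS _ _ _ _ (\bigcup_k F k)); last first.
  apply: negligible_bigcup => k; rewrite /F; case: unpickle => [q|]; last exact: negligible_set0.
  by case: asboolP => // _; exact: negligible_set0.
move=> x /existsNP[U] /not_implyP[oU] /not_implyP[Ux] /negP.
rewrite -leNgt => U0.
have [q qx qU] := nbhs_rat_box x U (open_nbhs_nbhs (conj oU Ux)).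
have nU : nu.-negligible (U : set (Mx R m n)).
  apply/negligibleP; first exact: sub_sigma_algebra.
  by apply/eqP; rewrite -measure_le0.
exists (pickle q) => //; rewrite /F pickleK.
by case: asboolP => // -[]; exact: negligibleS nU.
Qed.

End support.

(** * Convex cones in finite dimension and the extension of positive linear forms *)

Section cones.
Context {R : realType} {N : nat}.
Implicit Types (E H : set 'rV[R]_N) (x v w : 'rV[R]_N) (l : 'cV[R]_N).

Definition pairing x l : R := (x *m l) 0 0.

Lemma pairingD x v l : pairing (x + v) l = pairing x l + pairing v l.
Proof. by rewrite /pairing mulmxDl mxE. Qed.

Lemma pairingZ a x l : pairing (a *: x) l = a * pairing x l.
Proof. by rewrite /pairing -scalemxAl mxE. Qed.

Lemma pairing_sum I (s : seq I) (f : I -> 'rV[R]_N) l :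
  pairing (\sum_(i <- s) f i) l = \sum_(i <- s) pairing (f i) l.
Proof. by rewrite /pairing mulmx_suml summxE. Qed.

Definition convex_cone H :=
  [/\ H 0, forall x v, H x -> H v -> H (x + v) &
      forall a x, 0 <= a -> H x -> H (a *: x)].

(** Finite conic combinations, given inductively so that a representing measure can be built by
    adding one Dirac mass at a time. *)
Inductive cone_hull E : set 'rV[R]_N :=
| cone_hull0 : cone_hull E 0
| cone_hullD a v x : 0 <= a -> E v -> cone_hull E x -> cone_hull E (a *: v + x).

Lemma convex_cone_hull E : convex_cone (cone_hull E).
Proof.
split; first exact: cone_hull0.
  move=> x v; elim=> [|a u y a0 Eu _ IH] Hv; first by rewrite add0r.
  by rewrite -addrA; apply: cone_hullD => //; exact: IH.
move=> a x a0; elim=> [|b u y b0 Eu _ IH]; first by rewrite scaler0; exact: cone_hull0.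
by rewrite scalerDr scalerA; apply: cone_hullD => //; rewrite mulr_ge0.
Qed.

Lemma sub_cone_hull E : E `<=` cone_hull E.
Proof.
move=> v Ev; rewrite -[v]addr0 -[v]scale1r.
by apply: cone_hullD => //; exact: cone_hull0.
Qed.

Lemma convex_cone_sum H I (s : seq I) (f : I -> 'rV[R]_N) :
  convex_cone H -> (forall i, H (f i)) -> H (\sum_(i <- s) f i).
Proof.
move=> [H0 HD _] Hf; elim: s => [|i s IH]; first by rewrite big_nil.
by rewrite big_cons; exact: HD.
Qed.

(** Greedy choice: a vector of [E] outside the row space raises the rank, which cannot exceed [N].
    The induction shows that either a spanning family exists or some family has rank at least
    [d]. *)
Lemma exists_spanning_rows E :
  exists k (B : 'M[R]_(k, N)), (forall i, E (row i B)) /\ forall v, E v -> (v <= B)%MS.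
Proof.
suff : (exists k (B : 'M[R]_(k, N)), (forall i, E (row i B)) /\
    forall v, E v -> (v <= B)%MS) \/
  (exists k (B : 'M[R]_(k, N)), (forall i, E (row i B)) /\ (N.+1 <= \rank B)%N).
  by case=> // -[k [B [_]]]; rewrite leqNgt ltnS rank_leq_col.
elim: N.+1 => [|d [IH|[k [B [EB dB]]]]]; [right|by left|].
  by exists 0%N, 0; split=> // -[].
have [spB|/existsNP[v /not_implyP[Ev /negP vB]]] := pselect (forall v, E v -> (v <= B)%MS).
  by left; exists k, B.
right; exists (k + 1)%N, (col_mx B v); split.
  move=> i; rewrite -[i]splitK; case: (fintype.split i) => j /=; rewrite ?rowKu ?rowKd//.
  by rewrite ord1 row_id.
rewrite (leq_ltn_trans dB)// -addsmxE; apply: rank_ltmx.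
by rewrite /ltmx addsmxSl addsmx_sub submx_refl.
Qed.

(** The kernel of [cokermx U] is exactly the row space of [U], so one of its columns is nonzero at
    [w]; dividing by that value normalizes it. *)
Lemma separating_column k (U : 'M[R]_(k, N)) w : ~~ (w <= U)%MS ->
  exists2 l, forall u, (u <= U)%MS -> pairing u l = 0 & pairing w l = 1.
Proof.
rewrite submxE => /rV0Pn[j wj].
exists (((w *m cokermx U) 0 j)^-1 *: col j (cokermx U)).
  move=> u; rewrite submxE => /eqP uU.
  rewrite /pairing -scalemxAr mxE (_ : (u *m _) 0 0 = (u *m cokermx U) 0 j).
    by rewrite uU [X in _ * X]mxE mulr0.
  by rewrite [LHS]mxE [RHS]mxE; apply: eq_bigr => i _; rewrite mxE.
rewrite /pairing -scalemxAr mxE (_ : (w *m _) 0 0 = (w *m cokermx U) 0 j) ?mulVf//.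
by rewrite [LHS]mxE [RHS]mxE; apply: eq_bigr => i _; rewrite mxE.
Qed.

(** Here [p] is an order unit for [H] on the row space of [W]. The form is extended from [U] one
    dimension at a time, by induction on the codimension of [U] in [W]; multiples of [p] bound the
    value at the new direction from both sides. *)
Lemma riesz_extension H (W U : 'M[R]_N) p l :
  convex_cone H -> (forall x, H x -> (x <= W)%MS) ->
  (forall x, (x <= W)%MS -> exists2 t, 0 <= t & H (t *: p + x)) ->
  (p <= U)%MS -> (U <= W)%MS ->
  (forall x, H x -> (x <= U)%MS -> 0 <= pairing x l) ->
  exists l', pairing p l' = pairing p l /\ forall x, H x -> 0 <= pairing x l'.
Proof.
move=> [H0 HD HZ] HW unit.
have [k] := ubnP (\rank W - \rank U); elim: k U l => // k IH U l kU pU UW lU.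
have [WU|/row_subPn[i wU]] := boolP (W <= U)%MS.
  exists l; split => // x Hx; apply: lU => //; exact: submx_trans (HW _ Hx) WU.
set w := row i W in wU.
have wW : (w <= W)%MS by exact: row_sub.
(* Lower bounds for the value at [w]: [u + w] in [H] forces it to be at least [- pairing u l], while
   [u - w] in [H] forces it to be at most [pairing u l]. The supremum of [S] meets both demands. *)
pose S := [set r | exists u, [/\ (u <= U)%MS, H (u + w) & r = - pairing u l]].
have ub u : (u <= U)%MS -> H (u - w) -> ubound S (pairing u l).
  move=> uU Hu _ [v [vU Hv ->]]; rewrite -subr_ge0 opprK -pairingD; apply: lU.
    by rewrite (_ : u + v = (u - w) + (v + w)); [exact: HD|rewrite addrACA addNr addr0].
  by rewrite addmx_sub.
have S0 : S !=set0.
  have [t _ Ht] := unit w wW; exists (- pairing (t *: p) l), (t *: p); split => //.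
  by rewrite scalemx_sub.
have Sub : has_ubound S.
  have [|t _ Ht] := unit (- w); first by rewrite eqmx_opp.
  by exists (pairing (t *: p) l); apply: ub => //; rewrite scalemx_sub.
pose al := sup S.
have al1 u : (u <= U)%MS -> H (u + w) -> 0 <= pairing u l + al.
  move=> uU Hu; rewrite -lerBlDl sub0r; apply: ub_le_sup => //.
  by exists u.
have al2 u : (u <= U)%MS -> H (u - w) -> al <= pairing u l.
  by move=> uU Hu; apply: ge_sup => //; exact: ub.
have [phi phiU phiw] := separating_column N U w wU.
(* The form [l1] agrees with [l] on [U] and takes the value [al] at [w]. *)
pose l1 := l + (al - pairing w l) *: phi.
have l1E u s : (u <= U)%MS -> pairing (u + s *: w) l1 = pairing u l + s * al.
  move=> uU; have pl v : pairing v l1 = pairing v l + (al - pairing w l) * pairing v phi.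
    by rewrite /pairing mulmxDr -scalemxAr mxE [X in _ + X]mxE.
  by rewrite pairingD pairingZ !pl phiU// phiw mulr0 addr0 mulr1 addrCA subrr addr0.
have ltU : (U < U + w)%MS.
  by rewrite /ltmx addsmxSl addsmx_sub submx_refl.
have U'W : (U + w <= W)%MS by rewrite addsmx_sub UW wW.
have [||||l' [l'p l'H]] := IH (U + w)%MS l1.
- rewrite -ltnS; apply: leq_trans _ kU; rewrite ltnS.
  by apply: ltn_sub2l; [exact: leq_trans (rank_ltmx ltU) (mxrankS U'W)|exact: rank_ltmx].
- exact: submx_trans pU (addsmxSl _ _).
- exact: U'W.
- move=> x Hx /sub_addsmxP[[c d] /= xE].
  have [s sE] : exists s, d *m w = s *: w.
    by exists (d 0 0); rewrite [in LHS](mx11_scalar d) mul_scalar_mx.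
  set u := c *m U in xE; have uU : (u <= U)%MS by exact: submxMl.
  rewrite sE in xE; rewrite xE l1E//.
  have [s0|s0|s0] := ltgtP s 0.
  + have s0' : 0 < (- s)^-1 by rewrite invr_gt0 oppr_gt0.
    have := al2 ((- s)^-1 *: u) (scalemx_sub _ uU).
    rewrite (_ : _ - w = (- s)^-1 *: x); last first.
      by rewrite xE scalerDr scalerA invrN mulNr mulVf ?scaleN1r// lt_eqF.
    move/(_ (HZ _ _ (ltW s0') Hx)); rewrite pairingZ mulrC ler_pdivlMr ?oppr_gt0//.
    by rewrite mulrN mulrC -subr_ge0 opprK.
  + have s0' : 0 < s^-1 by rewrite invr_gt0.
    have := al1 (s^-1 *: u) (scalemx_sub _ uU).
    rewrite (_ : _ + w = s^-1 *: x); last first.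
      by rewrite xE scalerDr scalerA mulVf ?scale1r// gt_eqF.
    move/(_ (HZ _ _ (ltW s0') Hx)); rewrite pairingZ -(pmulr_rge0 _ s0).
    by rewrite mulrDr mulrA divff ?mul1r ?gt_eqF.
  + rewrite s0 mul0r addr0; apply: lU => //.
    by move: Hx; rewrite xE s0 scale0r addr0.
- exists l'; split => //; rewrite l'p.
  by rewrite -[p in LHS]addr0 -(scale0r w) l1E// mul0r addr0.
Qed.

(** Let [p] be [v] plus the sum [q] of a spanning family of [E]. Were [- p] outside the hull, the
    form equal to 1 at [p] would extend to one nonnegative on [E], which then vanishes on [E] and so
    at [p]. Hence [- p] is in the hull, and adding [q] gives [- v]. *)
Lemma opp_cone_hull E :
  (forall l, (forall v, E v -> 0 <= pairing v l) -> forall v, E v -> pairing v l = 0) ->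
  forall v, E v -> cone_hull E (- v).
Proof.
move=> El v Ev; have HC := convex_cone_hull E; have [H0 HD HZ] := HC.
have [k [B [EB spB]]] := exists_spanning_rows E.
have HB i : cone_hull E (row i B) by exact/sub_cone_hull.
set q := \sum_i row i B.
have Hq : cone_hull E q by exact: convex_cone_sum.
have [p pE] : exists p, p = v + q by exists (v + q).
have [Hp|nHp] := pselect (cone_hull E (- p)).
  by rewrite (_ : - v = - p + q); [exact: HD|rewrite pE opprD subrK].
have Hp : cone_hull E p by rewrite pE; apply: HD => //; exact: sub_cone_hull.
have HB' x : cone_hull E x -> (x <= B)%MS.
  elim=> [|a u y a0 Eu _ IH]; first exact: sub0mx.
  by apply: addmx_sub => //; apply/scalemx_sub/spB.
have p0 : p != 0 by apply/eqP => p0; apply: nHp; rewrite p0 oppr0.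
have [j pj] := rV0Pn _ p0.
pose l0 : 'cV[R]_N := (p 0 j)^-1 *: delta_mx j 0.
have l0p : pairing p l0 = 1.
  by rewrite /pairing -scalemxAr mxE -colE mxE mulVf.
have [|||||l [lp lH]] := riesz_extension (cone_hull E) <<B>>%MS <<p>>%MS p l0 HC.
- by move=> x /HB'; rewrite genmxE.
- move=> x; rewrite genmxE => /submxP[D ->].
  (* With this multiple of [p] every row gets a nonnegative coefficient, so [p] is an order unit. *)
  exists (\sum_i `|D 0 i|); first exact: sumr_ge0.
  have -> : (\sum_i `|D 0 i|) *: p + D *m B =
      (\sum_i `|D 0 i|) *: v +
      \sum_i ((\sum_i `|D 0 i|) + D 0 i) *: row i B.
    rewrite pE scalerDr -addrA; congr (_ + _); rewrite scaler_sumr mulmx_sum_row.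
    by rewrite -big_split; apply: eq_bigr => i _; rewrite scalerDl.
  apply: HD; first by apply: HZ; [exact: sumr_ge0|exact: sub_cone_hull].
  apply: convex_cone_sum => // i; apply: HZ => //.
  rewrite (bigD1 i)//= addrAC addr_ge0 ?sumr_ge0//.
  by rewrite -lerBlDr sub0r -normrN ler_norm.
- by rewrite genmxE.
- by rewrite !genmxE HB'.
(* A negative multiple of [p] in the hull would put [- p] there. *)
- move=> x Hx; rewrite genmxE => /sub_rVP[a xE]; rewrite xE pairingZ l0p mulr1.
  rewrite leNgt; apply/negP => a0; apply: nHp.
  rewrite (_ : - p = (- a)^-1 *: x); first by apply: HZ => //; rewrite invr_ge0 oppr_ge0 ltW.
  by rewrite xE scalerA invrN mulNr mulVf ?scaleN1r// lt_eqF.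
have E0 u : E u -> pairing u l = 0.
  by apply: El => w Ew; apply: lH; exact: sub_cone_hull.
move/eqP: lp; rewrite l0p pE pairingD E0// pairing_sum big1 ?addr0; last by move=> i _; exact/E0.
by rewrite eq_sym oner_eq0.
Qed.

End cones.

(** * Homogeneous combinations of minors *)

Section minor_sums.
Context {R : realType} {m n : nat}.
Implicit Types (X A : 'M[R]_(m, n)) (b : minor_index m n -> R).

Definition minor_sum b X := \sum_p b p * minor p X.

Definition homogeneous k b := forall p, b p != 0 -> #|(val p).1| = k.

Definition homogeneous_part b k : minor_index m n -> R :=
  fun p => if #|(val p).1| == k then b p else 0.

Lemma homogeneous_partP b k : homogeneous k (homogeneous_part b k).
Proof. by move=> p; rewrite /homogeneous_part; case: (_ =P k) => // _; rewrite eqxx. Qed.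

Lemma minor_sumZ k b a X : homogeneous k b ->
  minor_sum b (a *: X) = a ^+ k * minor_sum b X.
Proof.
move=> bk; rewrite /minor_sum mulr_sumr; apply: eq_bigr => p _.
have [->|/bk <-] := eqVneq (b p) 0; first by rewrite !mul0r mulr0.
by rewrite minorZ mulrCA.
Qed.

Lemma minor_sum_homogeneous b X :
  minor_sum b X = \sum_(k < m.+1) minor_sum (homogeneous_part b k) X.
Proof.
rewrite /minor_sum exchange_big/=; apply: eq_bigr => p _.
have pm : (#|(val p).1| < m.+1)%N by rewrite ltnS -[leqRHS]card_ord max_card.
rewrite (bigD1 (Ordinal pm))//= /homogeneous_part eqxx big1 ?addr0// => i ip.
case: eqP => [e|_]; last by rewrite mul0r.
by case/eqP: ip; apply/val_inj; rewrite /= e.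
Qed.

Lemma minor_affine_minor_sum b : minor_affine (minor_sum b).
Proof. by exists 0, b => X; rewrite add0r. Qed.

Lemma minor_sum0 b : minor_sum b 0 = 0.
Proof. by rewrite /minor_sum big1// => p _; rewrite minor0 mulr0. Qed.

Lemma exists_entry_minor (i : 'I_m) (j : 'I_n) :
  exists p : minor_index m n, #|(val p).1| = 1%N /\ forall X, minor p X = X i j.
Proof.
pose ij := ([set i]%SET, [set j]%SET).
have ijP : (#|ij.1| == #|ij.2|) && (0 < #|ij.1|)%N by rewrite !cards1.
pose p : minor_index m n := exist _ ij ijP.
have e : 1%N = #|(val p).1| by rewrite cards1.
exists p; split=> // X; rewrite minor_mxsub -(det_mxsub_cast _ _ _ _ _ e) det_mx11 !mxE.
congr (X _ _).
  by apply/set1P; exact: (@enum_valP _ (mem (val p).1)).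
by apply/set1P; exact: (@enum_valP _ (mem (val p).2)).
Qed.

Lemma entry_sum_minor_sum (be : 'M[R]_(m, n)) : exists2 b, homogeneous 1 b &
  forall X, minor_sum b X = \sum_i \sum_j be i j * X i j.
Proof.
pose q i j := projT1 (cid (exists_entry_minor i j)).
have qP i j : #|(val (q i j)).1| = 1%N /\ forall X, minor (q i j) X = X i j.
  exact: projT2 (cid (exists_entry_minor i j)).
exists (fun p => \sum_i \sum_j be i j * (p == q i j)%:R).
  move=> p; apply: contraNeq => p1; apply/eqP.
  rewrite big1// => i _; rewrite big1// => j _.
  case: eqP => [pq|_]; last by rewrite mulr0.
  by case/eqP: p1; rewrite pq; case: (qP i j).
move=> X; rewrite /minor_sum; under eq_bigr do rewrite mulr_suml.
rewrite exchange_big/=; apply: eq_bigr => i _.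
under eq_bigr do rewrite mulr_suml.
rewrite exchange_big/=; apply: eq_bigr => j _.
rewrite (bigD1 (q i j))//= eqxx mulr1 big1 ?addr0; first by case: (qP i j) => _ ->.
by move=> p /negbTE ->; rewrite mulr0 mul0r.
Qed.

(** Each entry is a minor of order 1, so its coefficient is added to that of this minor. *)
Lemma lincomb_minor_sum bm (be : 'M[R]_(m, n)) :
  exists b, forall X, lincomb bm be X = minor_sum b X.
Proof.
have [b _ bE] := entry_sum_minor_sum be; exists (fun p => bm p + b p) => X.
rewrite /lincomb -bE /minor_sum -big_split; apply: eq_bigr => p _ /=.
by rewrite mulrDl.
Qed.

(** Linear forms are combinations of minors of order 1. The separating form is later used to keep a
    zero set of homogeneous combinations inside [K]. *)
Lemma subspace_separation (K : set 'M[R]_(m, n)) X : is_subspace K -> ~ K X ->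
  exists b, [/\ homogeneous 1 b, {morph minor_sum b : Y Z / Y - Z},
    forall Y, K Y -> minor_sum b Y = 0 & minor_sum b X <> 0].
Proof.
move=> [K0 KD] KX.
have [k [B [BK KB]]] := exists_spanning_rows [set v | K (vec_mx v)].
have XB : ~~ (mxvec X <= B)%MS.
  apply/negP => /submxP[D XE]; apply: KX.
  rewrite -[X]mxvecK XE mulmx_sum_row linear_sum/=.
  elim: (index_enum _) => [|i s IH]; first by rewrite big_nil.
  by rewrite big_cons linearZ/=; apply: KD => //; exact: (BK i).
have [l lB lX] := separating_column _ _ _ XB.
have [b b1 bE] := entry_sum_minor_sum (vec_mx l^T).
have {}bE Y : minor_sum b Y = pairing (mxvec Y) l.
  rewrite bE pair_bigA/= /pairing mxE (reindex _ (curry_mxvec_bij _ _))/=.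
  by apply: eq_bigr => -[i j] _ /=; rewrite mxvecE !mxE mulrC.
exists b; split => // [Y Z|Y KY|]; rewrite ?bE; last by rewrite lX; apply/eqP/oner_neq0.
  by rewrite -scaleN1r linearD linearZ pairingD pairingZ mulN1r.
by apply: lB; apply: KB; rewrite /= mxvecK.
Qed.

(* The restriction of f to the ray through z is t^k (f_k(z) + O(t)). *)
Lemma lowest_part_ge0 b k X (k_le : (k <= m)%N) :
  (forall t, 0 < t -> 0 <= minor_sum b (t *: X)) ->
  (forall d, (d < k)%N -> minor_sum (homogeneous_part b d) X = 0) ->
  0 <= minor_sum (homogeneous_part b k) X.
Proof.
move=> bX low; rewrite leNgt; apply/negP => c0.
set c := minor_sum (homogeneous_part b k) X in c0.
pose f d := minor_sum (homogeneous_part b d) X.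
pose C := \sum_(d < m.+1) `|f d|.
have C0 : 0 <= C by exact: sumr_ge0.
have D0 : 0 < C - c + 1 by lra.
have [t [t0 t1 tC]] : exists t, [/\ 0 < t, t <= 1 & c + t * C < 0].
  (* The denominator exceeds both [- c] and [C], which gives [t <= 1] and [t * C < - c]. *)
  exists (- c / (C - c + 1)); split; first by rewrite divr_gt0// oppr_gt0.
    by rewrite ler_pdivrMr// mul1r; lra.
  rewrite mulrAC -ltrBrDl sub0r ltr_pdivrMr// ltr_pM2l ?oppr_gt0//; lra.
have := bX t t0; rewrite minor_sum_homogeneous leNgt => /negP; apply.
under eq_bigr do rewrite (minor_sumZ _ _ _ _ (homogeneous_partP _ _)).
apply: (@le_lt_trans _ _ (t ^+ k * (c + t * C))); last first.
  by rewrite pmulr_rlt0 ?exprn_gt0.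
have km : (k < m.+1)%N by [].
rewrite (bigD1 (Ordinal km))//= mulrDr lerD2l.
apply: (@le_trans _ _ (\sum_(d < m.+1 | d != Ordinal km) t ^+ k * (t * `|f d|))).
  (* Orders below [k] contribute 0; for orders above [k], [t <= 1] gives [t ^+ d <= t ^+ k.+1]. *)
  apply: ler_sum => d dk; have [dlt|dgt|de] := ltngtP d k.
  - by rewrite low// mulr0 !mulr_ge0 ?exprn_ge0 ?(ltW t0).
  - rewrite mulrA -exprSr; apply: (@le_trans _ _ (t ^+ d * `|f d|)).
      by rewrite ler_wpM2l ?ler_norm// exprn_ge0// ltW.
    by rewrite ler_wpM2r// ler_wiXn2l// ltW.
  - by case/eqP: dk; exact/val_inj.
rewrite -mulr_sumr ler_wpM2l ?exprn_ge0 ?(ltW t0)// -mulr_sumr ler_wpM2l ?(ltW t0)//.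
by rewrite /C [leRHS](bigD1 (Ordinal km))//= lerDr.
Qed.

End minor_sums.

(** * Measures satisfying the minor identities, under the cone condition *)

Section rigidity.
Context {R : realType} {m n : nat}.
Variables (K : set 'M[R]_(m, n)) (nu : probability (Mx R m n) R).
Hypothesis nuK : Mpc K nu.
Local Notation A := (barycenter nu).
Local Notation S := (Defs.support nu).

(** The identities for minors extend linearly, and the constant integrates to itself because [nu]
    has mass 1. *)
Lemma Mpc_affine (f : 'M[R]_(m, n) -> R) : minor_affine f ->
  nu.-integrable [set: Mx R m n] (fun x => (f x)%:E) /\
  (\int[nu]_(x in [set: Mx R m n]) (f x)%:E = (f A)%:E)%E.
Proof.
have [_ [iM eM]] := nuK; move=> [c [b fE]].
have ib p : nu.-integrable [set: Mx R m n] (fun x => (b p)%:E * (minor p x)%:E)%E.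
  exact: integrableZl.
have ic : nu.-integrable [set: Mx R m n] (fun=> c%:E).
  exact: finite_measure_integrable_cst.
have fE' : (fun x : Mx R m n => (f x)%:E) =
    (fun x => (c%:E + \sum_p (b p)%:E * (minor p x)%:E)%E).
  apply/funext => x; rewrite fE EFinD -sumEFin; congr (_ + _)%E.
have iS : nu.-integrable [set: Mx R m n] (fun x => \sum_p (b p)%:E * (minor p x)%:E)%E.
  exact: integrable_sum.
rewrite fE'; split; first exact: integrableD.
rewrite integralD// integral_cst//= probability_setT mule1 fE EFinD -sumEFin.
congr (_ + _)%E; rewrite integral_sum//; apply: eq_bigr => p _.
by rewrite integralZl// eM.
Qed.

Lemma ae_support (P : Mx R m n -> Prop) : (forall x, S x -> P x) -> {ae nu, forall x, P x}.
Proof.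
by move=> SP; apply: negligibleS (support_conull nu) => x /= nP Sx; apply: nP; exact: SP.
Qed.

(** A nonnegative function of mean 0 vanishes almost everywhere. By continuity the set where [f] is
    nonzero is open, and an open set meeting the support has positive measure. *)
Lemma eq0_on_support (f : 'M[R]_(m, n) -> R) : continuous f -> minor_affine f ->
  (forall x, S x -> 0 <= f x) -> f A = 0 -> forall x, S x -> f x = 0.
Proof.
move=> cf af f0 fA x Sx; apply: contrapT => /eqP fx.
have mf : measurable_fun [set: Mx R m n] (EFin \o (f : Mx R m n -> R)).
  by apply/measurable_EFinP; exact: continuous_measurable_mx.
have [_ intf] := Mpc_affine f af.
pose U : set (Mx R m n) := [set x | f x != 0].
have oU : open (U : set 'M[R]_(m, n)).
  by have /continuousP/(_ [set y | y != 0]) := cf; apply; exact: open_neq.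
have nf : nu.-negligible U.
  have : ae_eq nu [set: Mx R m n] (EFin \o f) (cst 0%E).
    apply/(ae_eq_integral_abs _ measurableT mf).
    transitivity (f A)%:E; last by rewrite fA.
    rewrite -intf; apply: ae_eq_integral => //; first exact: measurableT_comp.
    by apply: ae_support => y Sy _ /=; rewrite ger0_norm ?f0.
  apply: negligibleS => y /= fy yP; case/eqP: fy.
  by have /= [] := yP I.
have := Sx U oU fx; rewrite (measure_negligible _ nf) ?ltxx//.
exact: sub_sigma_algebra.
Qed.

Lemma minor_sum_barycenter b : (forall x, S x -> minor_sum b x = 0) -> minor_sum b A = 0.
Proof.
move=> b0; have [_ intb] := Mpc_affine _ (minor_affine_minor_sum b).
have mb : measurable_fun [set: Mx R m n] (EFin \o (minor_sum b : Mx R m n -> R)).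
  apply/measurable_EFinP; apply: continuous_measurable_mx.
  exact: continuous_minor_sum.
apply: EFin_inj; rewrite -intb (ae_eq_integral (cst 0%E))//; first by rewrite integral0.
by apply: ae_support => y Sy _ /=; rewrite b0.
Qed.

(** The translated combination is still affine in the minors, so its mean is its value at [A], which
    is 0. *)
Lemma minor_sum_centered b : (forall x, S x -> 0 <= minor_sum b (x - A)) ->
  forall x, S x -> minor_sum b (x - A) = 0.
Proof.
move=> b0; apply: (eq0_on_support (fun x => minor_sum b (x - A))) => //.
- have cA : continuous (fun y : 'M[R]_(m, n) => y - A).
    by move=> y; exact: (cvgB cvg_id (cvg_cst A)).
  by move=> x; exact: (continuous_comp (cA x) (continuous_minor_sum b _)).
- exact: minor_affine_translate (minor_affine_minor_sum b).
- by rewrite subrr minor_sum0.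
Qed.

Lemma is_dirac_support : (forall x, S x -> x = A) -> is_dirac nu.
Proof.
move=> SA; exists A => B mB; rewrite diracE; case: (boolP (A \in B)) => [|/negP] AB.
  rewrite -[B]setCK probability_setC; last exact: measurableC.
  rewrite (@measure_negligible _ _ _ _ (~` B)) ?sube0//; first exact: measurableC.
  apply: negligibleS (support_conull nu) => x Bx /SA xA; apply: Bx.
  by rewrite xA; exact/set_mem.
apply: measure_negligible => //; apply: negligibleS (support_conull nu) => x Bx /SA xA.
by apply/AB/mem_set; rewrite -xA.
Qed.

Lemma Mpc_is_dirac : is_subspace K ->
  (forall V : set 'M[R]_(m, n),
    is_cone V -> is_algebraic V -> V `<=` K -> (exists x, V x /\ x <> 0) ->
    exists b, (forall z, V z -> 0 <= minor_sum b z) /\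
      (exists z, V z /\ minor_sum b z <> 0)) ->
  is_dirac nu.
Proof.
move=> sK HV; have [SK _] := nuK; apply: is_dirac_support => x Sx.
pose W := [set b | (exists k, homogeneous k b) /\
  forall s, S s -> minor_sum b (s - A) = 0].
pose V : set 'M[R]_(m, n) := [set X | forall b, W b -> minor_sum b X = 0].
have VS s : S s -> V (s - A) by move=> Ss b [_]; apply.
have coneV : is_cone V.
  move=> X a VX a0 b Wb; have [[k bk] _] := Wb.
  by rewrite (minor_sumZ _ _ _ _ bk) VX// mulr0.
apply: contrapT => xA; have [||||b [b0 [z [Vz bz]]]] := HV V.
- exact: coneV.
- exists [set P | exists2 b, W b &
    forall X, mpoly.meval (fun i => mxvec X 0 i) P = minor_sum b X].
  apply/seteqP; split => X /=.
    by move=> VX P [b Wb ->]; exact: VX.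
  move=> PX b Wb; have [P PE] := polynomial_fun_minor_sum b.
  by rewrite -[minor_sum b X]PE; apply: PX; exists b.
(* A linear form vanishing on [K] but not at [X] vanishes on the support and at its mean [A], hence
   belongs to [W]; this contradicts [V X]. *)
- move=> X VX; apply: contrapT => /(subspace_separation _ _ sK)[b [b1 bB bK]]; apply.
  apply: VX; split; [by exists 1%N|move=> s Ss].
  have bS y : S y -> minor_sum b y = 0 by move=> /SK; exact: bK.
  by rewrite bB bS// minor_sum_barycenter// subrr.
- by exists (x - A); split; [exact: VS|move/subr0_eq].
(* The least order whose homogeneous part is not identically zero on [V]. *)
have [k [k_le [y [Vy fy]] kmin]] : exists k, [/\ (k <= m)%N,
    exists y, V y /\ minor_sum (homogeneous_part b k) y <> 0 &
    forall d y, (d < k)%N -> V y -> minor_sum (homogeneous_part b d) y = 0].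
  pose P k := `[< (k <= m)%N /\ exists y, V y /\ minor_sum (homogeneous_part b k) y <> 0 >].
  have exP : exists k, P k.
    apply: contrapT => nP; apply: bz; rewrite minor_sum_homogeneous big1// => d _.
    apply: contrapT => dz; apply: nP; exists d; apply/asboolP; split; first by rewrite -ltnS.
    by exists z.
  have [k /asboolP[km kz] kmin] := ex_minnP exP; exists k; split => // d y dk Vy.
  apply: contrapT => dy; suff /kmin : P d by rewrite leqNgt dk.
  apply/asboolP; split; first exact: leq_trans (ltnW dk) km.
  by exists y.
(* It suffices that this part lies in [W]. As the lowest part it is nonnegative on the centred
   support, and mean zero makes it vanish there. *)
apply: fy; apply: (Vy (homogeneous_part b k)); split.
  by exists k; exact: homogeneous_partP.
apply: minor_sum_centered => s Ss; apply: lowest_part_ge0 => //.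
  by move=> t t0; apply/b0/coneV => //; exact: VS.
by move=> d dk; apply: kmin => //; exact: VS.
Qed.

End rigidity.

(** * Scaling and normalizing measures *)

Section scaled_measure.
Local Open Scope ereal_scope.
Context d (T : measurableType d) (R : realType).
Variables (mu : {measure set T -> \bar R}) (k : {nonneg R}) (f : T -> \bar R).
Hypothesis fi : mu.-integrable [set: T] f.

Lemma integrable_mscale : (mscale k mu).-integrable [set: T] f.
Proof.
have /integrableP[mf foo] := fi; apply/integrableP; split => //.
rewrite ge0_integral_mscale//; first by rewrite lte_mul_pinfty.
exact: measurableT_comp.
Qed.

Lemma integral_mscale :
  \int[mscale k mu]_(x in [set: T]) f x = k%:num%:E * \int[mu]_(x in [set: T]) f x.
Proof.
have mf := measurable_int mu fi.
rewrite [X in _ = _ * X]integralE muleBr//; last exact: integrable_add_def.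
rewrite [LHS]integralE !ge0_integral_mscale//.
- exact: measurable_funeneg.
- exact: measurable_funepos.
Qed.

End scaled_measure.

Lemma exists_normalization d (T : measurableType d) (R : realType)
    (mu : {measure set T -> \bar R}) (M : R) : 0 < M -> mu [set: T] = M%:E ->
  exists nu : probability T R, (forall A, nu A = M^-1%:E * mu A)%E /\
    forall f, mu.-integrable [set: T] f -> nu.-integrable [set: T] f /\
      (\int[nu]_(x in [set: T]) f x = M^-1%:E * \int[mu]_(x in [set: T]) f x)%E.
Proof.
move=> M0 muT; have M1 : 0 <= M^-1 by rewrite invr_ge0 ltW.
(* The Dirac mass is the default of [mnormalize] for total mass 0 or infinity, cases excluded by
   [M0] and [muT]. *)
pose nu : probability T R := mnormalize mu (dirac point).
have nuE A : nu A = (M^-1%:E * mu A)%E.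
  by rewrite /nu/= /mnormalize/= muT eqe gt_eqF//= muleC.
have nuI f : (\int[nu]_(x in [set: T]) f x =
    \int[mscale (NngNum M1) mu]_(x in [set: T]) f x)%E.
  by apply: eq_measure_integral => A _ _; exact: nuE.
exists nu; split => // f fi; split; last by rewrite nuI integral_mscale.
have /integrableP[mf foo] := integrable_mscale _ _ _ mu (NngNum M1) f fi.
by apply/integrableP; split => //; rewrite nuI.
Qed.

(** * Finitely supported measures from conic combinations of minor vectors *)

Section laminates.
Context {R : realType} {m n : nat}.
Implicit Types (V : set 'M[R]_(m, n)).

Definition minor_row (X : 'M[R]_(m, n)) : 'rV[R]_#|{: minor_index m n}| :=
  \row_k minor (enum_val k) X.

Lemma minor_rowE X p : minor_row X 0 (enum_rank p) = minor p X.
Proof. by rewrite mxE enum_rankK. Qed.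

(** A finite measure carried by finitely many points of [V], with [x] as its vector of integrals of
    minors. Being carried by [s] is expressed by vanishing on measurable sets that miss [s]. *)
Definition finite_representation V (mu : {measure set (Mx R m n) -> \bar R})
    (x : 'rV[R]_#|{: minor_index m n}|) :=
  [/\ exists2 M, 0 <= M & mu [set: Mx R m n] = M%:E,
   exists2 s : seq 'M[R]_(m, n), (forall z, z \in s -> V z) &
     forall A : set (Mx R m n), measurable A -> (forall z, z \in s -> ~ A z) -> mu A = 0%E,
   forall p, mu.-integrable [set: Mx R m n] (fun X => (minor p X)%:E) &
   forall p, (\int[mu]_(X in [set: Mx R m n]) (minor p X)%:E = (x 0 (enum_rank p))%:E)%E].

Lemma measurable_minor p :
  measurable_fun [set: Mx R m n] (EFin \o (minor p : Mx R m n -> R)).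
Proof.
by apply/measurable_EFinP; apply: continuous_measurable_mx; exact: continuous_minor.
Qed.

Lemma finite_representation_dirac V z mu x a : 0 <= a -> V z ->
  finite_representation V mu x ->
  exists mu', finite_representation V mu' (a *: minor_row z + x) /\
    forall A, (mu' A = a%:E * \d_(z : Mx R m n) A + mu A)%E.
Proof.
move=> a0 Vz [[M M0 muM] [s sV s0] iM eM].
pose dz : {measure set (Mx R m n) -> \bar R} := dirac (z : Mx R m n).
have mu'E A : measure_add (mscale (NngNum a0) dz) mu A =
    (a%:E * \d_(z : Mx R m n) A + mu A)%E by rewrite measure_addE.
have idz p : dz.-integrable [set: Mx R m n] (fun X => (minor p X)%:E).
  apply/integrableP; split; first exact: measurable_minor.
  rewrite integral_dirac//; first by rewrite diracT mul1e ltry.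
  by apply: measurableT_comp => //; exact: measurable_minor.
have iadz p := integrable_mscale _ _ _ dz (NngNum a0) _ (idz p).
exists (measure_add (mscale (NngNum a0) dz) mu); split; last exact: mu'E.
split.
- exists (a + M); first exact: addr_ge0.
  by apply: (etrans (mu'E _)); rewrite muM diracT mule1.
- exists (z :: s) => [y|B mB Bs]; first by rewrite inE => /predU1P[->|/sV].
  apply: (etrans (mu'E _)); rewrite s0// => [|y ys]; last by apply: Bs; rewrite inE ys orbT.
  rewrite adde0 diracE memNset ?mule0//; apply: Bs; exact: mem_head.
- move=> p; have /integrableP[mp p1] := iadz p; have /integrableP[_ p2] := iM p.
  apply/integrableP; split => //.
  rewrite ge0_integral_measure_add//; first exact: lte_add_pinfty.
  exact: measurableT_comp.
- move=> p; rewrite integral_measure_add// integral_mscale//.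
  rewrite integral_dirac//; last exact: measurable_minor.
  by rewrite eM diracT mul1e -EFinM -EFinD mxE mxE minor_rowE.
Qed.

Lemma cone_hull_finite_representation V x : cone_hull (minor_row @` V) x ->
  exists mu, finite_representation V mu x.
Proof.
elim=> [|a _ y a0 [z Vz <-] _ [mu muP]].
  exists mzero; split.
  - by exists 0.
  - by exists [::].
  - move=> p; apply/integrableP; split; first exact: measurable_minor.
    by rewrite integral_measure_zero.
  - by move=> p; rewrite integral_measure_zero mxE.
by have [mu' [mu'P _]] := finite_representation_dirac _ _ _ _ _ a0 Vz muP; exists mu'.
Qed.

(** Adding a unit mass at [z] to a measure representing [- minor_row z] gives a positive measure
    whose minors all integrate to 0. After normalization the barycenter is 0, where every minor
    vanishes, while [z] keeps positive mass. *)
Lemma exists_nondirac V z : V z -> z <> 0 ->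
  cone_hull (minor_row @` V) (- minor_row z) ->
  exists nu : probability (Mx R m n) R, Mpc V nu /\ ~ is_dirac nu.
Proof.
move=> Vz z0 /cone_hull_finite_representation[mu0 mu0P].
have [mu [[[M M0 muM] [s sV s0] iM eM] muE]] :=
  finite_representation_dirac _ _ _ _ _ ler01 Vz mu0P.
have mz A : A z -> (1 <= mu A)%E.
  by move=> Az; rewrite muE diracE mem_set// mul1e leeDl.
have {}M0 : 0 < M.
  by have := mz [set: Mx R m n] I; rewrite muM lee_fin; apply: lt_le_trans.
have [nu [nuE nuI]] := exists_normalization _ _ _ mu M M0 muM.
have nu0 p : (\int[nu]_(X in [set: Mx R m n]) (minor p X)%:E = 0)%E.
  by have [_ ->] := nuI _ (iM p); rewrite eM scale1r subrr mxE mule0.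
have bar0 : barycenter nu = 0.
  apply/matrixP => i j; rewrite !mxE.
  have [p [_ pE]] := exists_entry_minor (R := R) i j.
  by under eq_integral do rewrite -pE; rewrite nu0.
have closed_seq (t : seq 'M[R]_(m, n)) : open (~` [set` t]).
  have hM : hausdorff_space 'M[R]_(m, n) by exact: norm_hausdorff.
  by apply: closed_openC; apply: (proj1 accessible_finite_set_closed
    (hausdorff_accessible hM)); exact: finite_seq.
exists nu; split.
  split; last by split=> p; [have [] := nuI _ (iM p)|rewrite nu0 bar0 minor0].
  move=> X SX; apply: sV; apply: contrapT => Xs.
  have : (0 < nu (~` [set` s]))%E := SX _ (closed_seq s) Xs.
  rewrite nuE s0 ?mule0 ?ltxx//; first by apply: sub_sigma_algebra; exact: closed_seq.
  by move=> y ys /=; apply.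
move=> [a aE].
(* A Dirac measure charging [z] must sit at [z]. *)
have za : a = z.
  apply: contrapT => az; have mU : measurable ([set z] : set (Mx R m n)).
    rewrite -[X in measurable X]setCK; apply: measurableC; apply: sub_sigma_algebra.
    rewrite (_ : [set z] = [set` [:: z]]); first exact: closed_seq.
    by apply/seteqP; split => y /=; rewrite inE => /eqP.
  have := aE _ mU; rewrite nuE diracE memNset// => /eqP.
  rewrite mule_eq0 eqe invr_eq0 gt_eqF//= => /eqP mu0z.
  by have := mz [set z] erefl; rewrite mu0z lee_fin ler10.
(* The Dirac mass at [z] has the entries of [z] as means, and these means are 0. *)
apply: z0; apply/matrixP => i j.
have [p [_ pE]] := exists_entry_minor (R := R) i j; rewrite -pE mxE.
apply: EFin_inj; apply: etrans (nu0 p); rewrite -za.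
transitivity (\int[\d_a]_(X in [set: Mx R m n]) (minor p X)%:E)%E.
  by rewrite integral_dirac//; [rewrite diracT mul1e|exact: measurable_minor].
by apply/esym/eq_measure_integral => B mB _; exact: aE.
Qed.

End laminates.

(** * The two implications of the equivalence *)

Theorem theorem1 (R : realType) (m n : nat) (K : set 'M[R]_(m, n)) :
  is_subspace K ->
  ((forall nu : probability (Mx R m n) R, Mpc K nu -> is_dirac nu) <->
   (forall V : set 'M[R]_(m, n),
      is_cone V -> is_algebraic V -> V `<=` K ->
      (exists x, V x /\ x <> 0) ->
      exists (bm : minor_index m n -> R) (be : 'M[R]_(m, n)),
        ~ (bm = (fun=> 0) /\ be = 0) /\
        (forall z, V z -> 0 <= lincomb bm be z) /\
        (exists z, V z /\ lincomb bm be z <> 0))).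
Proof.
move=> sK; split=> [nuD V coneV algV VK [z [Vz z0]]|HV nu nuK]; last first.
  apply: (Mpc_is_dirac K nu nuK sK) => V coneV algV VK Vz.
  have [bm [be [_ [b0 [z [Vz' bz]]]]]] := HV V coneV algV VK Vz.
  have [b bE] := lincomb_minor_sum bm be; exists b; split.
    by move=> y Vy; rewrite -bE; exact: b0.
  by exists z; rewrite -bE.
apply: contrapT => nb.
have minor_sum_pairing (l : 'cV[R]_#|{: minor_index m n}|) (X : 'M[R]_(m, n)) :
    lincomb (fun p => l (enum_rank p) 0) 0 X = pairing (minor_row X) l.
  rewrite /lincomb [X in _ + X]big1 ?addr0 => [|i _]; last first.
    by rewrite big1// => j _; rewrite mxE mul0r.
  rewrite /pairing mxE (reindex _ (onW_bij _ (enum_rank_bij _))).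
  by apply: eq_bigr => p _; rewrite minor_rowE mulrC.
have [|nu [[nuV nuM] nuN]] := exists_nondirac V z Vz z0; last first.
  by apply/nuN/nuD; split => // X /nuV /VK.
apply: opp_cone_hull; last by exists z.
(* A form nonnegative on the minor vectors of [V] and nonzero at one of them is an admissible choice
   of coefficients, with 0 on the entries; none exists by [nb]. *)
move=> l l0 _ [y Vy <-]; apply: contrapT => ly; apply: nb.
exists (fun p => l (enum_rank p) 0), 0; split; last split.
- move=> [bm0 _]; apply: ly; rewrite -minor_sum_pairing bm0 /lincomb.
  rewrite !big1 ?addr0// => i _; last by rewrite mul0r.
  by rewrite big1// => j _; rewrite mxE mul0r.
- by move=> X VX; rewrite minor_sum_pairing; apply: l0; exists X.
- by exists y; rewrite minor_sum_pairing.
Qed.
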